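(* Let $t$ be an ordinary $\lambda$-term and let $(\leadsto,\leadsto_X)$ be a high-level implementation system. Then: (1) $t$ is $\leadsto$-normalising if and only if it is $\leadsto_X$-normalising; (2) if $\rho: t\leadsto_X^* u$ then $\rho\!\downarrow : t\leadsto^* u\!\downarrow$ and $|\rho| = O(|\rho\!\downarrow|^2)$.
   Context: LSC terms: $t,u::= x\mid \lambda x.t\mid tu\mid t[x\leftarrow u]$ ($t[x\leftarrow u]$ is an explicit substitution (ES) binding $x$ in $t$), modulo $\alpha$-equivalence; ordinary $\lambda$-terms are LSC terms without ES. Shallow contexts: $C::=\langle\cdot\rangle\mid \lambda x.C\mid Ct\mid tC\mid C[x\leftarrow t]$; substitution contexts: $L::=\langle\cdot\rangle\mid L[x\leftarrow t]$. The reduction of the LSC is the closure under shallow contexts of the rules ${\tt dB}$: $(L\langle\lambda x.t\rangle)u\to L\langle t[x\leftarrow u]\rangle$ and ${\tt ls}$: $C\langle x\rangle[x\leftarrow u]\to C\langle u\rangle[x\leftarrow u]$ (with $C$ not capturing $x$; $\alpha$-renaming on the fly to avoid capture). The unfolding $t\!\downarrow$ is defined by $x\!\downarrow=x$, $(tu)\!\downarrow=t\!\downarrow u\!\downarrow$, $(\lambda x.t)\!\downarrow=\lambda x.t\!\downarrow$, $(t[x\leftarrow u])\!\downarrow = t\!\downarrow\{x\leftarrow u\!\downarrow\}$. For a derivation $\rho$, $|\rho|$ is its length, $|\rho|_{\tt dB}$ its number of ${\tt dB}$-steps, and $\rho\!\downarrow$ is the $\beta$-derivation $t\!\downarrow\to_\beta^*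 u\!\downarrow$ obtained by projecting $\rho$ via unfolding. $|u|_{[\,]}$ is the number of ES in $u$. A strategy is a sub-relation of the reduction; a pair $(\leadsto,\leadsto_X)$, where $\leadsto$ is a deterministic strategy on $\lambda$-terms and $\leadsto_X$ a strategy of the LSC, is a high-level implementation system if whenever $t$ is a $\lambda$-term and $\rho:t\leadsto_X^* u$: (normal form) if $u$ is $\leadsto_X$-normal then $u\!\downarrow$ is $\leadsto$-normal; (projection) $\rho\!\downarrow : t\leadsto^* u\!\downarrow$ and $|\rho\!\downarrow| = |\rho|_{\tt dB}$; (trace) $|u|_{[\,]} = |\rho|_{\tt dB}$; (syntactic bound) the length of any sequence of substitution (${\tt ls}$) steps of $\leadsto_X$ starting from $u$ is bounded by $|u|_{[\,]}$. *)

(* Defs.v *)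
From Stdlib Require Import Arith Lia Relations.

Set Implicit Arguments.

(** Terms modulo alpha-equivalence, in de Bruijn notation.
    [ES t u] is t[x<-u]: index 0 is bound in [t] and not in [u]. *)
Inductive term : Type :=
| Var (n : nat)
| Lam (t : term)
| App (t u : term)
| ES (t u : term).

(** |t|_[] *)
Fixpoint es_count (t : term) : nat :=
  match t with
  | Var _ => 0
  | Lam t => es_count t
  | App t u => es_count t + es_count u
  | ES t u => S (es_count t + es_count u)
  end.

Definition lambda_term (t : term) : Prop := es_count t = 0.

Definition up_ren (r : nat -> nat) (n : nat) : nat :=
  match n with 0 => 0 | S n => S (r n) end.

Fixpoint ren (r : nat -> nat) (t : term) : term :=
  match t with
  | Var n => Var (r n)
  | Lam t => Lam (ren (up_ren r) t)
  | App t u => App (ren r t) (ren r u)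
  | ES t u => ES (ren (up_ren r) t) (ren r u)
  end.

Definition lift (k : nat) (t : term) : term := ren (fun n => k + n) t.

Definition up (s : nat -> term) (n : nat) : term :=
  match n with 0 => Var 0 | S n => lift 1 (s n) end.

Fixpoint subst (s : nat -> term) (t : term) : term :=
  match t with
  | Var n => s n
  | Lam t => Lam (subst (up s) t)
  | App t u => App (subst s t) (subst s u)
  | ES t u => ES (subst (up s) t) (subst s u)
  end.

Definition single (u : term) (n : nat) : term :=
  match n with 0 => u | S n => Var n end.

(** Meta-level substitution t{x<-u}, where x is index 0 of [t]. *)
Definition msubst (t u : term) : term := subst (single u) t.

Fixpoint unfolding (t : term) : term :=
  match t with
  | Var n => Var n
  | Lam t => Lam (unfolding t)
  | App t u => App (unfolding t) (unfolding u)
  | ES t u => msubst (unfolding t) (unfolding u)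
  end.

(** Shallow contexts: the hole is never inside the argument of an ES. *)
Inductive sctx : Type :=
| SHole
| SLam (C : sctx)
| SAppL (C : sctx) (t : term)
| SAppR (t : term) (C : sctx)
| SES (C : sctx) (t : term).

(** Plugging does not rename: the binders of [C] capture the indices of [r]
    smaller than [sdepth C]. *)
Fixpoint splug (C : sctx) (r : term) : term :=
  match C with
  | SHole => r
  | SLam C => Lam (splug C r)
  | SAppL C t => App (splug C r) t
  | SAppR t C => App t (splug C r)
  | SES C t => ES (splug C r) t
  end.

Fixpoint sdepth (C : sctx) : nat :=
  match C with
  | SHole => 0
  | SLam C => S (sdepth C)
  | SAppL C _ => sdepth C
  | SAppR _ C => sdepth C
  | SES C _ => S (sdepth C)
  end.

Inductive lctx : Type :=
| LHole
| LES (L : lctx) (t : term).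

Fixpoint lplug (L : lctx) (r : term) : term :=
  match L with
  | LHole => r
  | LES L t => ES (lplug L r) t
  end.

Fixpoint ldepth (L : lctx) : nat :=
  match L with
  | LHole => 0
  | LES L _ => S (ldepth L)
  end.

(** (L<\x.t>) u -> L<t[x<-u]>: [u] moves under the binders of [L]. *)
Inductive root_dB : term -> term -> Prop :=
| Root_dB L t u :
    root_dB (App (lplug L (Lam t)) u) (lplug L (ES t (lift (ldepth L) u))).

(** C<x>[x<-u] -> C<u>[x<-u].  Under the binders of [C], the variable of the ES
    has index [sdepth C] (so [C] does not capture it); the copy of [u] moves
    under these binders and under the ES. *)
Inductive root_ls : term -> term -> Prop :=
| Root_ls C u :
    root_ls (ES (splug C (Var (sdepth C))) u)
            (ES (splug C (lift (S (sdepth C)) u)) u).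

Inductive shallow_closure (R : term -> term -> Prop) : term -> term -> Prop :=
| Shallow C r r' : R r r' -> shallow_closure R (splug C r) (splug C r').

Definition dB : term -> term -> Prop := shallow_closure root_dB.
Definition ls : term -> term -> Prop := shallow_closure root_ls.
Definition lsc (t u : term) : Prop := dB t u \/ ls t u.

(** The side conditions ensure that both sides are ES-free. *)
Inductive beta : term -> term -> Prop :=
| Beta_root t u :
    lambda_term t -> lambda_term u -> beta (App (Lam t) u) (msubst t u)
| Beta_lam t t' : beta t t' -> beta (Lam t) (Lam t')
| Beta_appl t t' u : lambda_term u -> beta t t' -> beta (App t u) (App t' u)
| Beta_appr t u u' : lambda_term t -> beta u u' -> beta (App t u) (App t u').

Section Derivations.
Variables (A : Type) (step : A -> A -> Type).

Inductive derivation : A -> A -> Type :=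
| Dnil t : derivation t t
| Dcons t v u : step t v -> derivation v u -> derivation t u.
Arguments Dcons {t v u} _ _.

Fixpoint dlength t u (d : derivation t u) : nat :=
  match d with
  | Dnil _ => 0
  | Dcons _ d => S (dlength d)
  end.

Fixpoint follows (R : A -> A -> Prop) t u (d : derivation t u) : Prop :=
  match d with
  | Dnil _ => True
  | @Dcons t v u _ d => R t v /\ follows R d
  end.
End Derivations.

Arguments Dnil {A step} t.
Arguments Dcons {A step t v u} _ _.

Inductive lsc_step (t u : term) : Type :=
| Step_dB : dB t u -> lsc_step t u
| Step_ls : ls t u -> lsc_step t u.

Definition lsc_derivation : term -> term -> Type := derivation lsc_step.
Definition beta_derivation : term -> term -> Type := derivation beta.

Fixpoint dB_length t u (d : lsc_derivation t u) : nat :=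
  match d with
  | Dnil _ => 0
  | Dcons (Step_dB _) d => S (dB_length d)
  | Dcons (Step_ls _) d => dB_length d
  end.

Fixpoint only_ls t u (d : lsc_derivation t u) : Prop :=
  match d with
  | Dnil _ => True
  | Dcons (Step_dB _) _ => False
  | Dcons (Step_ls _) d => only_ls d
  end.

Lemma ren_ext t : forall r r', (forall n, r n = r' n) -> ren r t = ren r' t.
Proof.
induction t; intros r r' H; simpl; f_equal; auto;
  apply IHt || apply IHt1; intros [|n]; simpl; auto.
Qed.

Lemma subst_ext t : forall s s', (forall n, s n = s' n) -> subst s t = subst s' t.
Proof.
induction t; intros s s' H; simpl; f_equal; auto;
  apply IHt || apply IHt1; intros [|n]; simpl; auto; now rewrite H.
Qed.

Lemma ren_ren t : forall r r', ren r' (ren r t) = ren (fun n => r' (r n)) t.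
Proof.
induction t; intros r r'; simpl; f_equal; auto;
  rewrite IHt || rewrite IHt1; apply ren_ext; now intros [|n].
Qed.

Lemma subst_ren t : forall r s, subst s (ren r t) = subst (fun n => s (r n)) t.
Proof.
induction t; intros r s; simpl; f_equal; auto;
  rewrite IHt || rewrite IHt1; apply subst_ext; now intros [|n].
Qed.

Lemma ren_subst t : forall r s, ren r (subst s t) = subst (fun n => ren r (s n)) t.
Proof.
induction t; intros r s; simpl; f_equal; auto;
  rewrite IHt || rewrite IHt1; apply subst_ext; intros [|n]; auto;
  unfold up, lift; rewrite !ren_ren; now apply ren_ext.
Qed.

Lemma subst_up_lift s t : subst (up s) (lift 1 t) = lift 1 (subst s t).
Proof. unfold lift; now rewrite subst_ren, ren_subst. Qed.

Lemma subst_subst t :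
  forall s s', subst s' (subst s t) = subst (fun n => subst s' (s n)) t.
Proof.
induction t; intros s s'; simpl; f_equal; auto;
  rewrite IHt || rewrite IHt1; apply subst_ext; intros [|n]; auto;
  apply subst_up_lift.
Qed.

Lemma subst_id t : forall s, (forall n, s n = Var n) -> subst s t = t.
Proof.
induction t; intros s H; simpl; f_equal; auto;
  apply IHt || apply IHt1; intros [|n]; simpl; auto; now rewrite H.
Qed.

Lemma msubst_lift t u : msubst (lift 1 t) u = t.
Proof. unfold msubst, lift; rewrite subst_ren; now apply subst_id. Qed.

Lemma subst_msubst s t u :
  subst s (msubst t u) = msubst (subst (up s) t) (subst s u).
Proof.
unfold msubst; rewrite !subst_subst; apply subst_ext; intros [|n]; auto; simpl.
symmetry; apply msubst_lift.
Qed.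

Lemma unfolding_ren t : forall r, unfolding (ren r t) = ren r (unfolding t).
Proof.
induction t; intros r; simpl; try congruence.
rewrite IHt1, IHt2; unfold msubst; rewrite subst_ren, ren_subst.
apply subst_ext; now intros [|n].
Qed.

Lemma lambda_ren t : forall r, lambda_term t -> lambda_term (ren r t).
Proof.
unfold lambda_term; induction t; intros r H; simpl in *; auto.
- rewrite IHt1, IHt2; lia.
- lia.
Qed.

Lemma lambda_subst t : forall s, (forall n, lambda_term (s n)) ->
  lambda_term t -> lambda_term (subst s t).
Proof.
induction t; intros s Hs H; unfold lambda_term in *; simpl in *; auto.
- apply IHt; auto; intros [|n]; simpl; auto; now apply lambda_ren, Hs.
- rewrite IHt1, IHt2; auto; lia.
- lia.
Qed.

Lemma lambda_msubst t u :
  lambda_term t -> lambda_term u -> lambda_term (msubst t u).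
Proof.
intros Ht Hu; apply lambda_subst; auto; intros [|n]; auto; reflexivity.
Qed.

Lemma lambda_unfolding t : lambda_term (unfolding t).
Proof.
induction t; simpl; try reflexivity; auto.
- now unfold lambda_term in *; simpl; rewrite IHt1, IHt2.
- now apply lambda_msubst.
Qed.

(** Hence the projection of a derivation from a lambda-term [t], whose source is
    [unfolding t] by typing, is a derivation from [t]. *)
Lemma unfolding_lambda t : lambda_term t -> unfolding t = t.
Proof.
unfold lambda_term; induction t; simpl; intros H; auto.
- now rewrite IHt.
- rewrite IHt1, IHt2; auto; lia.
- lia.
Qed.

Lemma beta_subst t t' : beta t t' -> forall s, (forall n, lambda_term (s n)) ->
  beta (subst s t) (subst s t').
Proof.
assert (Hup : forall s, (forall n, lambda_term (s n)) ->
                forall n, lambda_term (up s n)).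
{ intros s Hs [|n]; [reflexivity | now apply lambda_ren]. }
induction 1; intros s Hs; simpl.
- rewrite subst_msubst; constructor; apply lambda_subst; auto.
- constructor; auto.
- constructor; auto; now apply lambda_subst.
- constructor; auto; now apply lambda_subst.
Qed.

Lemma beta_msubst t t' u :
  lambda_term u -> beta t t' -> beta (msubst t u) (msubst t' u).
Proof.
intros Hu H; apply beta_subst; auto; intros [|n]; auto; reflexivity.
Qed.

Lemma root_dB_unfolding L t : forall u,
  beta (unfolding (App (lplug L (Lam t)) u))
       (unfolding (lplug L (ES t (lift (ldepth L) u)))).
Proof.
induction L as [|L IH s]; intros u; simpl.
- replace (lift 0 u) with u.
  + constructor; apply lambda_unfolding.
  + symmetry; unfold lift; simpl; generalize u.
    assert (H : forall v r, (forall n, r n = n) -> ren r v = v); [|now intros; apply H].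
    induction v; intros r H; simpl; f_equal; auto;
      apply IHv || apply IHv1; intros [|n]; simpl; auto.
- rewrite <- (msubst_lift (unfolding u) (unfolding s)) at 1.
  generalize (beta_msubst (lambda_unfolding s) (IH (lift 1 u))); simpl.
  replace (lift (ldepth L) (lift 1 u)) with (lift (S (ldepth L)) u).
  + unfold msubst at 1, lift at 1; simpl; now rewrite unfolding_ren.
  + unfold lift; rewrite ren_ren; apply ren_ext; intros n; lia.
Qed.

Lemma dB_unfolding t u : dB t u -> beta (unfolding t) (unfolding u).
Proof.
destruct 1 as [C r r' [L t u]].
induction C as [| | | |]; simpl splug; try (constructor; auto; apply lambda_unfolding).
- apply root_dB_unfolding.
- apply beta_msubst; auto; apply lambda_unfolding.
Qed.

Lemma splug_unfolding C : forall s k u, s k = subst s (unfolding u) ->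
  subst s (unfolding (splug C (Var (k + sdepth C)))) =
  subst s (unfolding (splug C (lift (sdepth C) u))).
Proof.
assert (HS : forall k u, lift (S k) u = lift k (lift 1 u)).
{ intros k u; unfold lift; rewrite ren_ren; apply ren_ext; intros n; lia. }
induction C as [|C IH|C IH t|t C IH|C IH t]; intros s k u H; simpl.
- rewrite Nat.add_0_r, H; unfold lift; rewrite unfolding_ren, subst_ren.
  now apply subst_ext.
- rewrite HS, Nat.add_succ_r; f_equal.
  apply (IH (up s) (S k) (lift 1 u)); simpl.
  unfold lift at 2; rewrite unfolding_ren.
  fold (lift 1 (unfolding u)); now rewrite subst_up_lift, H.
- f_equal; auto.
- f_equal; auto.
- rewrite HS, Nat.add_succ_r; unfold msubst; rewrite !subst_subst.
  apply (IH _ (S k) (lift 1 u)); simpl.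
  rewrite H; unfold lift; rewrite unfolding_ren, subst_ren.
  now apply subst_ext.
Qed.

Lemma ls_unfolding t u : ls t u -> unfolding t = unfolding u.
Proof.
destruct 1 as [C r r' [D u]].
induction C as [| | | |]; simpl; try congruence.
replace (lift (S (sdepth D)) u) with (lift (sdepth D) (lift 1 u)).
- apply (splug_unfolding D (single (unfolding u)) 0).
  unfold lift; rewrite unfolding_ren; symmetry; apply msubst_lift.
- unfold lift; rewrite ren_ren; apply ren_ext; intros n; lia.
Qed.

(** The projection of a derivation via unfolding: each dB-step projects on a
    single beta-step (contexts being shallow), each ls-step on the identity. *)
Fixpoint project t u (d : lsc_derivation t u) :
    beta_derivation (unfolding t) (unfolding u) :=
  match d with
  | Dnil t => Dnil (unfolding t)
  | Dcons (Step_dB h) d => Dcons (dB_unfolding h) (project d)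
  | @Dcons _ _ _ _ u (Step_ls h) d =>
      match eq_sym (ls_unfolding h) in _ = x
        return beta_derivation x (unfolding u)
      with eq_refl => project d end
  end.

Definition strategy (R red : term -> term -> Prop) : Prop :=
  forall t u, R t u -> red t u.

Definition deterministic (R : term -> term -> Prop) : Prop :=
  forall t u v, R t u -> R t v -> u = v.

Definition normal (R : term -> term -> Prop) (t : term) : Prop :=
  forall u, ~ R t u.

Definition normalising (R : term -> term -> Prop) (t : term) : Prop :=
  exists u, clos_refl_trans term R t u /\ normal R u.

(** A derivation d : t ~>_X* u is an LSC derivation [d] with [follows RX d]. *)
Record high_level_implementation_system (R RX : term -> term -> Prop) : Prop := {
  hlis_strategy : strategy R beta;
  hlis_deterministic : deterministic R;
  hlis_lsc_strategy : strategy RX lsc;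
  hlis_normal_form : forall t u (d : lsc_derivation t u),
    lambda_term t -> follows RX d -> normal RX u -> normal R (unfolding u);
  hlis_projection : forall t u (d : lsc_derivation t u),
    lambda_term t -> follows RX d ->
    follows R (project d) /\ dlength (project d) = dB_length d;
  hlis_trace : forall t u (d : lsc_derivation t u),
    lambda_term t -> follows RX d -> es_count u = dB_length d;
  hlis_syntactic_bound : forall t u (d : lsc_derivation t u),
    lambda_term t -> follows RX d ->
    forall v (e : lsc_derivation u v),
      follows RX e -> only_ls e -> dlength e <= es_count u
}.

(* Main.v *)
Require Import Defs.
From Stdlib Require Import Arith.
From Stdlib Require Import Lia Relations Classical.

(** After [k] dB-steps from a lambda-term there are exactly [k] explicit
    substitutions (trace), so the block of ls-steps that follows has length at
    most [k] (syntactic bound).  A derivation with [m] dB-steps has therefore at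
    most [0 + 1 + ... + m] ls-steps, and [m] is the length of its projection.
    Normalisation transfers to the LSC because determinism of the strategy on
    lambda-terms bounds the length of all projections from a normalising term,
    hence of all derivations; conversely a normalising derivation projects on a
    normalising one. *)

Section Derivations.
Variables (A : Type) (step : A -> A -> Type) (R : A -> A -> Prop).
Notation deriv := (derivation step).

Fixpoint dapp {t u v} (d : deriv t u) : deriv u v -> deriv t v :=
  match d with
  | Dnil _ => fun e => e
  | Dcons h d => fun e => Dcons h (dapp d e)
  end.

Lemma dlength_dapp t u v (d : deriv t u) (e : deriv u v) :
  dlength (dapp d e) = dlength d + dlength e.
Proof. induction d; simpl; auto. Qed.

Lemma follows_dapp t u v (d : deriv t u) (e : deriv u v) :
  follows R d -> follows R e -> follows R (dapp d e).
Proof. induction d; simpl; intuition. Qed.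

Lemma follows_clos_refl_trans t u (d : deriv t u) :
  follows R d -> clos_refl_trans A R t u.
Proof.
induction d as [t|t v u h d IH]; simpl; intros H.
- apply rt_refl.
- apply rt_trans with v; [now apply rt_step | now apply IH].
Qed.

Hypothesis R_step : forall t u, R t u -> inhabited (step t u).

Lemma clos_refl_trans_follows t u :
  clos_refl_trans A R t u -> exists d : deriv t u, follows R d.
Proof.
induction 1 as [t u H|t|t v u _ [d Hd] _ [e He]].
- destruct (R_step _ _ H) as [h].
  exists (Dcons h (Dnil u)); simpl; auto.
- exists (Dnil t); exact I.
- exists (dapp d e); now apply follows_dapp.
Qed.

(** Excluded middle decides whether the current end has a successor; if so, the derivation is
    extended, which the length bound [N] allows only finitely often. *)
Lemma bounded_reaches_normal t N :
  (forall u (d : deriv t u), follows R d -> dlength d <= N) ->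
  exists u, clos_refl_trans A R t u /\ (forall v, ~ R u v).
Proof.
intros HN.
(* [k] is the remaining budget of steps: once it is exhausted, one further step would exceed [N]. *)
assert (H : forall k u (d : deriv t u), follows R d -> N <= dlength d + k ->
          exists w, clos_refl_trans A R u w /\ (forall v, ~ R w v)).
{ induction k as [|k IH]; intros u d Hd Hk;
    (destruct (classic (exists v, R u v)) as [[v Hv]|Hn];
     [|exists u; split; [apply rt_refl | intros v Hv; eauto]]);
    destruct (R_step _ _ Hv) as [h];
    assert (Hd' : follows R (dapp d (Dcons h (Dnil v))))
      by (apply follows_dapp; simpl; auto).
  - apply HN in Hd'; rewrite dlength_dapp in Hd'; simpl in Hd'; lia.
  - destruct (IH v _ Hd') as (w & Hw & Hnw).
    + rewrite dlength_dapp; simpl; lia.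
    + exists w; split; auto.
      apply rt_trans with v; [now apply rt_step | assumption]. }
apply (H N t (Dnil t)); simpl; auto.
Qed.

(** By determinism every derivation from [t] follows a prefix of the path to [w], so [n] is the
    length of that path. *)
Lemma deterministic_bounded t w :
  (forall t u v, R t u -> R t v -> u = v) ->
  clos_refl_trans A R t w -> (forall v, ~ R w v) ->
  exists n, forall u (d : deriv t u), follows R d -> dlength d <= n.
Proof.
intros Hdet H; apply clos_rt_rt1n in H.
induction H as [t|t y w Hty _ IH]; intros Hn.
- exists 0; intros u d; revert Hn.
  destruct d as [t|t v u h d]; simpl; intros Hn Hd; auto.
  destruct (Hn v); tauto.
- destruct (IH Hn) as [n IHn]; exists (S n); intros u d; revert Hty.
  destruct d as [t|t v u h d]; simpl; intros Hty Hd; [lia|].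
  destruct Hd as [Htv Hd].
  assert (v = y) by eauto; subst v.
  apply le_n_S; auto.
Qed.

End Derivations.

Lemma dB_length_dapp t u v (d : lsc_derivation t u) (e : lsc_derivation u v) :
  dB_length (dapp _ _ d e) = dB_length d + dB_length e.
Proof. induction d as [|? ? ? [h|h] d IH]; simpl; auto. Qed.

Lemma only_ls_dapp t u v (d : lsc_derivation t u) (e : lsc_derivation u v) :
  only_ls d -> only_ls e -> only_ls (dapp _ _ d e).
Proof. induction d as [|? ? ? [h|h] d IH]; simpl; auto. Qed.

Lemma only_ls_dB_length t u (d : lsc_derivation t u) :
  only_ls d -> dB_length d = 0.
Proof. induction d as [|? ? ? [h|h] d IH]; simpl; auto; tauto. Qed.

(** [lsc] is a disjunction in [Prop], so it yields an element of the type [lsc_step] only under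
    [inhabited]. *)
Lemma lsc_inhabited_step (RX : term -> term -> Prop) :
  strategy RX lsc -> forall t u, RX t u -> inhabited (lsc_step t u).
Proof.
intros HX t u H; destruct (HX _ _ H); constructor;
  [now apply Step_dB | now apply Step_ls].
Qed.

Section Bound.
Variables R RX : term -> term -> Prop.
Hypothesis sys : high_level_implementation_system R RX.

(** [s] is the part already performed of the current block of ls-steps, which
    started at [u0], after [dB_length d] dB-steps.  Twice the bound
    [m + (k + (k + 1) + ... + (k + m))] avoids the division by two. *)
Lemma quadratic_bound_from t : lambda_term t ->
  forall u v (e : lsc_derivation u v) u0
    (d : lsc_derivation t u0) (s : lsc_derivation u0 u),
  follows RX d -> follows RX s -> only_ls s -> follows RX e ->
  2 * (dlength s + dlength e) <=
  2 * dB_length e + (dB_length e + 1) * (2 * dB_length d + dB_length e).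
Proof.
intros Ht u v e.
induction e as [u|u w v h e IH]; intros u0 d s Hd Hs Hls He.
- pose proof (hlis_syntactic_bound sys d Ht Hd s Hs Hls) as Hb.
  rewrite (hlis_trace sys d Ht Hd) in Hb; simpl; lia.
- destruct He as [Hw He]; destruct h as [h|h]; simpl.
  (* A dB-step closes the block: [d] absorbs [s] and this step, and a new empty block starts at
     [w]. *)
  + pose proof (hlis_syntactic_bound sys d Ht Hd s Hs Hls) as Hb.
    rewrite (hlis_trace sys d Ht Hd) in Hb.
    pose (e0 := Dcons (Step_dB h) (Dnil w) : lsc_derivation u w).
    assert (Hd' : follows RX (dapp _ _ d (dapp _ _ s e0))).
    { repeat apply follows_dapp; simpl; auto. }
    specialize (IH w _ (Dnil w) Hd' I I He).
    rewrite !dB_length_dapp, (only_ls_dB_length _ _ s Hls) in IH.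
    simpl in IH; nia.
  (* An ls-step only lengthens the current block [s]. *)
  + pose (e0 := Dcons (Step_ls h) (Dnil w) : lsc_derivation u w).
    assert (Hs' : follows RX (dapp _ _ s e0)).
    { apply follows_dapp; simpl; auto. }
    assert (Hls' : only_ls (dapp _ _ s e0)).
    { apply only_ls_dapp; simpl; auto. }
    specialize (IH u0 d _ Hd Hs' Hls' He).
    rewrite dlength_dapp in IH; simpl in IH; lia.
Qed.

(** With [m] dB-steps the sharper bound is [m + m (m + 1) / 2], which is at most [2 m^2], with
    equality at [m = 1]. *)
Lemma quadratic_bound t u (d : lsc_derivation t u) :
  lambda_term t -> follows RX d -> dlength d <= 2 * dB_length d ^ 2.
Proof.
intros Ht Hd.
pose proof (quadratic_bound_from t Ht t u d t (Dnil t) (Dnil t) I I I Hd) as H.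
simpl in *; nia.
Qed.

Lemma normalising_projection t :
  lambda_term t -> normalising RX t -> normalising R t.
Proof.
intros Ht (u & Hu & Hn).
destruct (clos_refl_trans_follows _ lsc_step RX
  (lsc_inhabited_step RX (hlis_lsc_strategy sys)) t u Hu) as [d Hd].
exists (unfolding u); split.
- rewrite <- (unfolding_lambda Ht).
  apply follows_clos_refl_trans with (d := project d).
  now apply (hlis_projection sys).
- exact (hlis_normal_form sys d Ht Hd Hn).
Qed.

Lemma normalising_implementation t :
  lambda_term t -> normalising R t -> normalising RX t.
Proof.
intros Ht (w & Hw & Hn).
(* Projections start at [unfolding t], so the path to [w] is restated from there. *)
rewrite <- (unfolding_lambda Ht) in Hw.
destruct (deterministic_bounded _ beta R (unfolding t) w
  (hlis_deterministic sys) Hw Hn) as [n Hb].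
(* [n] bounds the length of every projection, that is, the number of dB-steps. *)
apply (bounded_reaches_normal _ lsc_step RX
  (lsc_inhabited_step RX (hlis_lsc_strategy sys)) t (2 * n ^ 2)).
intros u d Hd.
destruct (hlis_projection sys d Ht Hd) as [HR Hlen].
apply Hb in HR; rewrite Hlen in HR.
apply Nat.le_trans with (1 := quadratic_bound t u d Ht Hd).
apply Nat.mul_le_mono_l, Nat.pow_le_mono_l, HR.
Qed.

End Bound.

Theorem mainTheorem3 :
  exists c : nat,
  forall R RX : term -> term -> Prop,
  high_level_implementation_system R RX ->
  forall t : term, lambda_term t ->
  (normalising R t <-> normalising RX t) /\
  (forall (u : term) (d : lsc_derivation t u), follows RX d ->
     follows R (project d) /\ dlength d <= c * dlength (project d) ^ 2).
Proof.
exists 2; intros R RX sys t Ht; split.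
- split.
  + now apply normalising_implementation.
  + now apply normalising_projection.
- intros u d Hd.
  destruct (hlis_projection sys d Ht Hd) as [HR Hlen]; split; auto.
  rewrite Hlen; now apply (quadratic_bound R RX sys).
Qed.
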